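(* Let $I=\{1,\dots,N\}$, $J=\{1,\dots,M\}$, let $\mathcal{N}(j)\subseteq I$ for $j\in J$, and let $a_i\in\mathbb{R}^n$, $b_j\in\mathbb{R}^m$, $c_i\in\mathbb{R}^k$ (with $k<n$), $A_{ij}\in\mathbb{R}^{n\times m}$, $B_i\in\mathbb{R}^{k\times n}$ for $i\in I$, $j\in J$. Consider the linear program $$\min_{x\in(\mathbb{R}_+^{n})^{I},\ y\in(\mathbb{R}_+^{m})^{J}}\ \sum_{i=1}^N\langle a_i,x_i\rangle+\sum_{j=1}^M\langle b_j,y_j\rangle\quad\text{s.t.}\quad A_{ij}y_j=x_i\ (j\in J,\ i\in\mathcal{N}(j)),\qquad B_ix_i=c_i\ (i\in I),$$ and let $D$ be its feasible set. Let $\mathcal{P}$ be the mapping with values in $D$ defined by $\mathcal{P}(x,y)=(x',y')$, where for each $i\in I$ the vector $x_i'$ is the Euclidean projection of $x_i$ onto the set $\{\tilde x_i\in\mathbb{R}_+^n : B_i\tilde x_i=c_i\}$, and for each $j\in J$ $$y_j'\in\arg\min_{y_j\in\mathbb{R}_+^m}\langle b_j,y_j\rangle\quad\text{s.t.}\quad A_{ij}y_j=x_i',\ i\in\mathcal{N}(j).$$ If a sequence $(x^t,y^t)\in(\mathbb{R}^{n})^{I}\times(\mathbb{R}^{m})^{J}$, $t=1,2,\dots$, converges to the set of optimal solutions of the linear program, then $\mathcal{P}(x^t,y^t)$ converges to the set of optimal solutions of the linear program as well.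
   Context: $\mathbb{R}_+^n$ is the non-negative cone (orthant) of $\mathbb{R}^n$; $\langle\cdot,\cdot\rangle$ is the Euclidean inner product. $x=(x_i)_{i\in I}$ and $y=(y_j)_{j\in J}$ are collections of vectors. A sequence converges to a (nonempty) set if its Euclidean distance to that set tends to $0$. It is part of the definition that $\mathcal{P}$ is well defined as a mapping into $D$: the sets $\{\tilde x_i\in\mathbb{R}_+^n: B_i\tilde x_i=c_i\}$ are nonempty, and for the projected $x'$ each small linear program defining $y_j'$ is feasible and has a minimizer; when minimizers are not unique, $y_j'$ is an arbitrary chosen minimizer. *)

(* Defs.v *)
From HB Require Import structures.
From mathcomp Require Import all_boot all_order all_algebra.
From mathcomp Require Import all_classical all_reals all_analysis.

Set Implicit Arguments.
Unset Strict Implicit.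
Unset Printing Implicit Defensive.

Import Order.TTheory GRing.Theory Num.Theory.
Import numFieldNormedType.Exports.

Local Open Scope classical_set_scope.
Local Open Scope ring_scope.

(* The norm MathComp-Analysis puts on matrices and products is the sup norm,
   so the Euclidean structure is spelled out here. *)
Definition dotv (R : realType) (d : nat) (u v : 'cV[R]_d) : R :=
  \sum_(l < d) u l 0 * v l 0.

Definition enorm (R : realType) (d : nat) (u : 'cV[R]_d) : R :=
  Num.sqrt (dotv u u).

Definition orthant (R : realType) (d : nat) : set 'cV[R]_d :=
  [set u | forall l, 0 <= u l 0].

Definition argmin (T : Type) (R : realType) (f : T -> R) (S : set T) : set T :=
  [set z | S z /\ forall w, S w -> f z <= f w].

Definition lp_point (R : realType) (N M n m : nat) : Type :=
  (('I_N -> 'cV[R]_n) * ('I_M -> 'cV[R]_m))%type.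

Definition point_dist (R : realType) (N M n m : nat)
    (z w : lp_point R N M n m) : R :=
  Num.sqrt (\sum_(i < N) enorm (z.1 i - w.1 i) ^+ 2
            + \sum_(j < M) enorm (z.2 j - w.2 j) ^+ 2).

Definition set_dist (R : realType) (N M n m : nat)
    (z : lp_point R N M n m) (S : set (lp_point R N M n m)) : R :=
  inf [set point_dist z w | w in S].

(* Nonemptiness is required because [inf set0 = 0]. *)
Definition cvg_to_set (R : realType) (N M n m : nat)
    (u : nat -> lp_point R N M n m) (S : set (lp_point R N M n m)) : Prop :=
  S !=set0 /\ (fun t => set_dist (u t) S) @ \oo --> (0 : R).

Definition objective (R : realType) (N M n m : nat)
    (a : 'I_N -> 'cV[R]_n) (b : 'I_M -> 'cV[R]_m)
    (z : lp_point R N M n m) : R :=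
  \sum_(i < N) dotv (a i) (z.1 i) + \sum_(j < M) dotv (b j) (z.2 j).

Definition feasible (R : realType) (N M n m k : nat)
    (Nb : 'I_M -> {set 'I_N})
    (A : 'I_N -> 'I_M -> 'M[R]_(n, m))
    (B : 'I_N -> 'M[R]_(k, n)) (c : 'I_N -> 'cV[R]_k) :
    set (lp_point R N M n m) :=
  [set z | [/\ (forall i, orthant (z.1 i)), (forall j, orthant (z.2 j)),
               (forall j i, i \in Nb j -> A i j *m z.2 j = z.1 i) &
               (forall i, B i *m z.1 i = c i)]].

Definition lp_solutions (R : realType) (N M n m k : nat)
    (Nb : 'I_M -> {set 'I_N})
    (a : 'I_N -> 'cV[R]_n) (b : 'I_M -> 'cV[R]_m) (c : 'I_N -> 'cV[R]_k)
    (A : 'I_N -> 'I_M -> 'M[R]_(n, m)) (B : 'I_N -> 'M[R]_(k, n)) :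
    set (lp_point R N M n m) :=
  argmin (objective a b) (feasible Nb A B c).

Definition x_set (R : realType) (n k : nat) (Bi : 'M[R]_(k, n))
    (ci : 'cV[R]_k) : set 'cV[R]_n :=
  [set u | orthant u /\ Bi *m u = ci].

Definition y_set (R : realType) (N M n m : nat) (Nb : 'I_M -> {set 'I_N})
    (A : 'I_N -> 'I_M -> 'M[R]_(n, m)) (x : 'I_N -> 'cV[R]_n) (j : 'I_M) :
    set 'cV[R]_m :=
  [set v | orthant v /\ forall i, i \in Nb j -> A i j *m v = x i].

(* Since [P] is total, this entails that every [x_set] is nonempty and that
   every small linear program met by [P] has a minimizer; which minimizer is
   returned is left unconstrained. *)
Definition is_projection_map (R : realType) (N M n m k : nat)
    (Nb : 'I_M -> {set 'I_N}) (b : 'I_M -> 'cV[R]_m) (c : 'I_N -> 'cV[R]_k)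
    (A : 'I_N -> 'I_M -> 'M[R]_(n, m)) (B : 'I_N -> 'M[R]_(k, n))
    (P : lp_point R N M n m -> lp_point R N M n m) : Prop :=
  forall z : lp_point R N M n m,
    (forall i, argmin (fun u => enorm (z.1 i - u)) (x_set (B i) (c i))
                      ((P z).1 i)) /\
    (forall j, argmin (dotv (b j)) (y_set Nb A (P z).1 j) ((P z).2 j)).

Lemma projection_map_feasible (R : realType) (N M n m k : nat)
    (Nb : 'I_M -> {set 'I_N}) (b : 'I_M -> 'cV[R]_m) (c : 'I_N -> 'cV[R]_k)
    (A : 'I_N -> 'I_M -> 'M[R]_(n, m)) (B : 'I_N -> 'M[R]_(k, n))
    (P : lp_point R N M n m -> lp_point R N M n m) :
  is_projection_map Nb b c A B P -> forall z, feasible Nb A B c (P z).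
Proof.
move=> hP z; have [hx hy] := hP z; split.
- by move=> i; have [[]] := hx i.
- by move=> j; have [[]] := hy j.
- by move=> j i; have [[_ h] _] := hy j; exact: h.
- by move=> i; have [[]] := hx i.
Qed.

(* Main.v *)
Require Import Defs.
From HB Require Import structures.
From mathcomp Require Import all_boot all_order all_algebra.
From mathcomp Require Import all_classical all_reals all_analysis.
From mathcomp Require Import ring lra.

Set Implicit Arguments.
Unset Strict Implicit.
Unset Printing Implicit Defensive.

Import Order.TTheory GRing.Theory Num.Theory.
Import numFieldNormedType.Exports.

Local Open Scope classical_set_scope.
Local Open Scope ring_scope.

(** The map P moves points away from the solution set S by at most a fixed
factor: there is a constant K such that for every point z and every s in S
some s' in S satisfies dist (P z, s') <= K * dist (z, s)
([projection_map_calm]).  Taking the infimum over s gives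
dist (P z, S) <= (K + 1) * dist (z, S), and convergence to S is preserved
([cvg_to_set_calm]).

All of the work is in the existence of K, which has to be uniform because S
may be unbounded and no compactness is available.  The source of uniformity is
Hoffman's error bound ([hoffman_standard_form]): a nonnegative vector x that
violates a solvable linear system by r lies within C * r of a nonnegative
solution, where C depends on the coefficients of the system and not on its
right-hand side.  It is used twice.

- With s optimal and x' the projected first component of P z, each block of x'
  is at most twice as far from that of s as the block of z is, because the
  projection is at least as close to z as s is.  The y-part of s then nearly
  satisfies the constraints of the small linear programs for x'; Hoffman's bound
  moves it to a feasible point nearby, so the optimal values of the small
  programs grow at most linearly in dist (z, s) ([small_lp_value_lip]).  Hence
  the objective at P z exceeds the optimal value by O(dist (z, s)).

- S is itself the set of nonnegative solutions of a linear system, namely the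
  constraints together with the equation setting the objective to its optimal
  value.  The feasible point P z violates only that last equation, so
  its distance to S is bounded by a multiple of its excess objective
  ([lp_sharp]).

Hoffman's bound is proved by Fourier-Motzkin elimination
([hoffman_inequalities]), one variable at a time. *)

(** * Hoffman's error bound *)

Definition lform (R : realType) (V : finType) (a x : V -> R) : R :=
  \sum_v a v * x v.

Lemma lform_comb (R : realType) (V : finType) (l m : R) (a b x : V -> R) :
  lform (fun v => l * a v + m * b v) x = l * lform a x + m * lform b x.
Proof.
rewrite /lform !mulr_sumr -big_split; apply: eq_bigr => v _ /=; ring.
Qed.

Lemma lform_update (R : realType) (V : finType) (a x : V -> R) (v : V) (t : R) :
  lform a (fun u => if u == v then t else x u) = lform a x + (t - x v) * a v.
Proof.
rewrite /lform (bigD1 v) //= [in RHS](bigD1 v) //= eqxx.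
rewrite (eq_bigr (fun u => a u * x u)); first ring.
by move=> u /negbTE ->.
Qed.

Lemma lform_lip (R : realType) (V : finType) (a x y : V -> R) (d : R) :
  (forall v, `|x v - y v| <= d) ->
  `|lform a x - lform a y| <= (\sum_v `|a v|) * d.
Proof.
move=> h; rewrite /lform -sumrB mulr_suml.
apply: le_trans (ler_norm_sum _ _ _) _; apply: ler_sum => v _.
by rewrite -mulrBr normrM ler_wpM2l.
Qed.

(** The one-variable case of Hoffman's bound: the constraints on t are upper
bounds g i / al i (for al i > 0) and lower bounds g j / al j (for al j < 0).
The second and third hypotheses say that they are consistent, the last one
that 0 violates none of them by more than r. *)
Lemma interval_point (R : realType) (I : finType) (al g : I -> R) (r : R) :
  0 <= r ->
  (forall i, al i = 0 -> 0 <= g i) ->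
  (forall i j, 0 < al i -> al j < 0 -> 0 <= - al j * g i + al i * g j) ->
  (forall i, - (r * `|al i|) <= g i) ->
  exists2 t, `|t| <= r & forall i, t * al i <= g i.
Proof.
move=> r0 g0 gij gr.
(* The largest lower bound, but at least - r, which every upper bound allows. *)
pose t := \big[Order.max/- r]_(j | al j < 0) (g j / al j).
exists t.
  rewrite ler_norml bigmax_ge_id /=; apply: bigmax_le => [|j aj].
    by rewrite ge0_cp.
  by rewrite ler_ndivrMr //; have := gr j; rewrite ltr0_norm // mulrN opprK.
move=> i; have [ai|ai|ai] := ltgtP (al i) 0.
- by rewrite -ler_ndivrMr //; exact: le_bigmax_cond.
- rewrite -ler_pdivlMr //; apply: bigmax_le => [|j aj].
    by rewrite ler_pdivlMr // mulNr; have := gr i; rewrite gtr0_norm.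
  rewrite ler_ndivrMr // mulrAC ler_pdivrMr //.
  by have := gij i j ai aj; rewrite mulNr addrC subr_ge0 mulrC [al i * _]mulrC.
- by rewrite ai mulr0 g0.
Qed.

(** Hoffman's bound for systems of inequalities, uniform in the right-hand side
beta; solvability is witnessed by w.  Only the variables in s may differ
between x and w, which allows an induction on s without changing the
index type of the variables.  For the step, the variable v is eliminated by
Fourier-Motzkin: all nonnegative combinations of two constraints that cancel v
are formed, the induction hypothesis yields a point y near x solving that
derived system, and this makes the bounds that y puts on v consistent, so the
coordinate v can be corrected by [interval_point]. *)
Lemma hoffman_inequalities (R : realType) (V : finType) (s : seq V) :
  forall (I : finType) (a : I -> V -> R),
  exists2 C : R, 0 <= C &
    forall (beta : I -> R) (x w : V -> R) (e : R), 0 <= e ->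
      (forall v, v \notin s -> w v = x v) ->
      (forall i, lform (a i) w <= beta i) ->
      (forall i, lform (a i) x <= beta i + e) ->
    exists2 x' : V -> R, forall i, lform (a i) x' <= beta i &
      forall v, `|x v - x' v| <= C * e.
Proof.
elim: s => [|v s IH] I a.
  exists 0 => // beta x w e e0 wx hw hx; exists w => // v.
  by rewrite wx // subrr normr0 mul0r.
(* The derived constraint p = (i, j) is lam p times the i-th plus mu p times the
   j-th: the i-th itself when v does not occur in it, the combination cancelling
   v when its signs are opposite, and the trivial one otherwise. *)
pose lam (p : I * I) : R :=
  if a p.1 v == 0 then 1
  else if (0 < a p.1 v) && (a p.2 v < 0) then - a p.2 v else 0.
pose mu (p : I * I) : R :=
  if (0 < a p.1 v) && (a p.2 v < 0) then a p.1 v else 0.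
have lam0 p : 0 <= lam p.
  rewrite /lam; case: eqP => // _; case: ifP => // /andP[_ /ltW].
  by rewrite oppr_ge0.
have mu0 p : 0 <= mu p by rewrite /mu; case: ifP => // /andP[/ltW].
pose a' (p : I * I) u := lam p * a p.1 u + mu p * a p.2 u.
have a'v p : a' p v = 0.
  rewrite /a' /lam /mu; case: eqP => [->|_].
    by rewrite ltxx /= mulr0 mul0r addr0.
  by case: ifP => _; ring.
have [C C0 HC] := IH _ a'.
(* The derived constraints amplify a violation e to at most K * e. *)
pose K := \sum_p (lam p + mu p).
have lmK p : lam p + mu p <= K.
  rewrite /K (bigD1 p) //= lerDl; apply: sumr_ge0 => q _; exact: addr_ge0.
have K0 : 0 <= K by apply: sumr_ge0 => p _; exact: addr_ge0.
pose D := C * K.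
have D0 : 0 <= D by exact: mulr_ge0.
(* At y, every original constraint is violated by at most G * e. *)
pose G := 1 + (\sum_i \sum_u `|a i u|) * D.
have G0 : 0 <= G.
  rewrite addr_ge0 // mulr_ge0 //; apply: sumr_ge0 => i _; exact: sumr_ge0.
pose T := \sum_i `|a i v|^-1 * G.
have T0 : 0 <= T by apply: sumr_ge0 => i _; rewrite mulr_ge0 // invr_ge0.
exists (D + T); first exact: addr_ge0.
move=> beta x w e e0 wx hw hx.
(* The induction hypothesis compares x with w after resetting its coordinate v,
   which does not occur in the derived system. *)
have [||||y hy xy] := HC (fun p => lam p * beta p.1 + mu p * beta p.2) x
    (fun u => if u == v then x v else w u) (K * e).
- exact: mulr_ge0.
- move=> u us; case: eqP => [->//|/eqP uv]; apply: wx.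
  by rewrite inE negb_or uv.
- move=> p; rewrite lform_update a'v mulr0 addr0 lform_comb.
  by rewrite lerD // ler_wpM2l.
- move=> p; rewrite lform_comb.
  apply: (@le_trans _ _ (lam p * (beta p.1 + e) + mu p * (beta p.2 + e))).
    by rewrite lerD // ler_wpM2l.
  have := ler_wpM2r e0 (lmK p); lra.
have {}xy u : `|x u - y u| <= D * e by have := xy u; rewrite mulrA.
have [||||t tT ht] := @interval_point _ _ (fun i => a i v)
    (fun i => beta i - lform (a i) y) (T * e).
- exact: mulr_ge0.
- move=> i ai; have := hy (i, i).
  by rewrite lform_comb /lam /mu /= ai eqxx ltxx /= !mul0r !addr0 !mul1r subr_ge0.
- move=> i j ai aj; have := hy (i, j).
  rewrite lform_comb /lam /mu /= ai aj (gt_eqF ai) /=; lra.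
- move=> i; have [ai|ai] := eqVneq (a i v) 0.
    have := hy (i, i).
    rewrite lform_comb /lam /mu /= ai eqxx ltxx /= !mul0r !addr0 !mul1r.
    by rewrite normr0 mulr0 oppr0 subr_ge0.
  have GT : G * e <= T * e * `|a i v|.
    rewrite mulrAC; apply: ler_wpM2r => //.
    rewrite /T (bigD1 i) //= mulrDl mulrAC mulVf ?normr_eq0 // mul1r lerDl.
    by rewrite mulr_ge0 //; apply: sumr_ge0 => k _; rewrite mulr_ge0 // invr_ge0.
  have Ga : (\sum_u `|a i u|) * (D * e) <= (\sum_i \sum_u `|a i u|) * (D * e).
    apply: ler_wpM2r; first exact: mulr_ge0.
    rewrite [leRHS](bigD1 i) //= lerDl.
    by apply: sumr_ge0 => k _; exact: sumr_ge0.
  have := @lform_lip _ _ (a i) x y _ xy.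
  rewrite ler_norml => /andP[h _].
  have := hx i; move: GT; rewrite /G; lra.
exists (fun u => if u == v then y v + t else y u) => [i|u].
  by rewrite lform_update; have := ht i; lra.
case: eqP => [->|_].
  have -> : x v - (y v + t) = (x v - y v) - t by ring.
  by rewrite mulrDl (le_trans (ler_normB _ _)) // lerD.
by rewrite mulrDl (le_trans (xy u)) // lerDl mulr_ge0.
Qed.

(** Lets the constraints of a linear program be used as they are written,
without spelling out their coefficient vectors. *)
Definition linform (R : realType) (V : finType) (f : (V -> R) -> R) : Prop :=
  exists a, forall x, f x = lform a x.

Lemma linform_scaled_coord (R : realType) (V : finType) (c : R) (v : V) :
  linform (fun x : V -> R => c * x v).
Proof.
exists (fun u => if u == v then c else 0) => x.
rewrite /lform (bigD1 v) //= eqxx big1 ?addr0 // => u /negbTE ->.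
by rewrite mul0r.
Qed.

Lemma linform_add (R : realType) (V : finType) (f g : (V -> R) -> R) :
  linform f -> linform g -> linform (fun x => f x + g x).
Proof.
move=> [a fa] [b gb]; exists (fun v => a v + b v) => x.
rewrite fa gb /lform -big_split; apply: eq_bigr => v _ /=; ring.
Qed.

Lemma linform_sum (R : realType) (V J : finType) (f : J -> (V -> R) -> R) :
  (forall j, linform (f j)) -> linform (fun x => \sum_j f j x).
Proof.
move=> /choice[a fa]; exists (fun v => \sum_j a j v) => x.
under eq_bigr => j _ do rewrite fa.
rewrite /lform exchange_big; apply: eq_bigr => v _ /=.
by rewrite mulr_suml.
Qed.

Lemma linform0 (R : realType) (V : finType) : linform (fun _ : V -> R => 0).
Proof.
by exists (fun=> 0) => x; rewrite /lform big1 // => v _; rewrite mul0r.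
Qed.

(** Reduces to inequalities: each equation is a pair of opposite inequalities,
and each sign condition is one more; the latter hold at x, so the violation of
the whole system is that of the equations. *)
Lemma hoffman_standard_form (R : realType) (V I : finType)
    (F : I -> (V -> R) -> R) :
  (forall i, linform (F i)) ->
  exists2 C : R, 0 <= C & forall x w : V -> R,
    (forall v, 0 <= x v) -> (forall v, 0 <= w v) ->
    exists x' : V -> R, [/\ forall v, 0 <= x' v, forall i, F i x' = F i w &
      forall v, `|x v - x' v| <= C * \sum_i `|F i x - F i w|].
Proof.
move=> /choice[a Fa].
pose c (k : (I * bool) + V) : V -> R :=
  match k with
  | inl (i, s) => fun v => (-1) ^+ s * a i v
  | inr u => fun v => if v == u then -1 else 0
  end.
have cl i s x : lform (c (inl (i, s))) x = (-1) ^+ s * F i x.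
  by rewrite Fa /lform mulr_sumr; apply: eq_bigr => v _; rewrite mulrA.
have cr u x : lform (c (inr u)) x = - x u.
  rewrite /lform (bigD1 u) //= eqxx mulN1r big1 ?addr0 // => v /negbTE ->.
  by rewrite mul0r.
have [C C0 HC] := @hoffman_inequalities _ _ (enum V) _ c.
exists C => // x w x0 w0.
pose beta (k : (I * bool) + V) : R :=
  match k with inl (i, s) => (-1) ^+ s * F i w | inr _ => 0 end.
set e := \sum_i _.
have e0 : 0 <= e by exact: sumr_ge0.
have [|||x' hx' xx'] := HC beta x w e e0.
- by move=> v; rewrite mem_enum.
- by move=> [[i s]|u]; rewrite ?cl ?cr //= oppr_le0.
- move=> [[i s]|u]; last first.
    by rewrite cr add0r (le_trans _ e0) // oppr_le0.
  rewrite cl /= addrC -lerBlDr -mulrBr.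
  apply: (@le_trans _ _ `|F i x - F i w|).
    by rewrite (le_trans (ler_norm _)) // normrM normr_sign mul1r.
  by rewrite /e (bigD1 i) //= lerDl; exact: sumr_ge0.
exists x'; split=> // [v|i].
  by have := hx' (inr v); rewrite cr /= oppr_le0.
apply/eqP; rewrite eq_le.
have := hx' (inl (i, false)); rewrite cl /= expr0 !mul1r => ->.
by have := hx' (inl (i, true)); rewrite cl /= expr1 !mulN1r lerN2.
Qed.

(** * Linear forms and norms in coordinates *)

Lemma linform_dotv (R : realType) (V : finType) (d : nat) (p : 'cV[R]_d)
    (h : 'I_d -> V) :
  linform (fun x : V -> R => dotv p (\col_l x (h l))).
Proof.
apply: linform_sum => l; under eq_fun do rewrite mxE.
exact: linform_scaled_coord.
Qed.

Lemma linform_mulmx (R : realType) (V : finType) (p d : nat) (M : 'M[R]_(p, d))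
    (h : 'I_d -> V) (r : 'I_p) :
  linform (fun x : V -> R => (M *m \col_l x (h l)) r 0).
Proof.
under eq_fun do rewrite mxE.
apply: linform_sum => l; under eq_fun do rewrite mxE.
exact: linform_scaled_coord.
Qed.

Lemma dotv_lip (R : realType) (d : nat) (p y z : 'cV[R]_d) (e : R) :
  (forall l, `|y l 0 - z l 0| <= e) ->
  dotv p y <= dotv p z + (\sum_l `|p l 0|) * e.
Proof.
move=> h; rewrite -lerBlDl.
exact: le_trans (ler_norm _) (@lform_lip _ _ (p^~ 0) (y^~ 0) (z^~ 0) e h).
Qed.

Lemma enormK (R : realType) (d : nat) (y : 'cV[R]_d) :
  enorm y ^+ 2 = \sum_l y l 0 ^+ 2.
Proof.
rewrite sqr_sqrtr; first by apply: eq_bigr => l _; rewrite expr2.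
by apply: sumr_ge0 => l _; rewrite -expr2 sqr_ge0.
Qed.

Lemma enorm_coord (R : realType) (d : nat) (y : 'cV[R]_d) l :
  `|y l 0| <= enorm y.
Proof.
rewrite -(@ler_pXn2r _ 2) ?nnegrE ?sqrtr_ge0 //.
rewrite enormK real_normK ?num_real // (bigD1 l) //= lerDl.
by apply: sumr_ge0 => k _; exact: sqr_ge0.
Qed.

Lemma point_distK (R : realType) (N M n m : nat)
    (z w : lp_point R N M n m) : point_dist z w ^+ 2 =
  \sum_(i < N) enorm (z.1 i - w.1 i) ^+ 2 +
  \sum_(j < M) enorm (z.2 j - w.2 j) ^+ 2.
Proof.
rewrite sqr_sqrtr // addr_ge0 //; apply: sumr_ge0 => i _; exact: sqr_ge0.
Qed.

Lemma enorm_le_point_dist1 (R : realType) (N M n m : nat)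
    (z w : lp_point R N M n m) i : enorm (z.1 i - w.1 i) <= point_dist z w.
Proof.
rewrite -(@ler_pXn2r _ 2) ?nnegrE ?sqrtr_ge0 // point_distK (bigD1 i) //=.
rewrite -addrA lerDl addr_ge0 //; apply: sumr_ge0 => k _; exact: sqr_ge0.
Qed.

Lemma point_dist_le_coord (R : realType) (N M n m : nat)
    (z w : lp_point R N M n m) (e : R) : 0 <= e ->
  (forall i r, `|z.1 i r 0 - w.1 i r 0| <= e) ->
  (forall j l, `|z.2 j l 0 - w.2 j l 0| <= e) ->
  point_dist z w <= Num.sqrt ((N * n + M * m)%:R) * e.
Proof.
move=> e0 h1 h2; rewrite -(@ler_pXn2r _ 2) ?nnegrE ?mulr_ge0 ?sqrtr_ge0 //.
have en d (y : 'cV[R]_d) :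
    (forall l, `|y l 0| <= e) -> enorm y ^+ 2 <= d%:R * e ^+ 2.
  move=> h; rewrite enormK mulr_natl -[X in _ *+ X]card_ord -sumr_const.
  apply: ler_sum => l _.
  by rewrite -[leLHS]real_normK ?num_real // ler_pXn2r ?nnegrE.
have sc q (y : R) : q%:R * y = \sum_(i < q) y.
  by rewrite sumr_const card_ord mulr_natl.
rewrite point_distK exprMn sqr_sqrtr // natrD mulrDl !natrM -!mulrA.
rewrite (sc N) (sc M); apply: lerD; apply: ler_sum => i _; apply: en => l.
  by rewrite !mxE.
by rewrite !mxE.
Qed.

(** * Distance to a set *)

Lemma set_dist_le (R : realType) (N M n m : nat)
    (z : lp_point R N M n m) (S : set (lp_point R N M n m)) w :
  S w -> set_dist z S <= point_dist z w.
Proof.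
move=> Sw; apply: ge_inf; last by exists w.
by exists 0 => _ [y _ <-]; exact: sqrtr_ge0.
Qed.

Lemma set_dist_ge0 (R : realType) (N M n m : nat)
    (z : lp_point R N M n m) (S : set (lp_point R N M n m)) : 0 <= set_dist z S.
Proof.
have [[w Sw]|] := pselect (S !=set0).
  apply: lb_le_inf; first by exists (point_dist z w), w.
  by move=> _ [y _ <-]; exact: sqrtr_ge0.
move=> /nonemptyPn ->; rewrite /set_dist image_set0 inf0 //.
Qed.

(** The distance from f z to S is then at most (K + 1) times that from z; the
added 1 makes the factor positive, so that it can be divided out under the
infimum. *)
Lemma cvg_to_set_calm (R : realType) (N M n m : nat)
    (S : set (lp_point R N M n m)) (f : lp_point R N M n m -> lp_point R N M n m)
    (u : nat -> lp_point R N M n m) (K : R) : 0 <= K ->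
  (forall z s, S s -> exists2 s', S s' &
     point_dist (f z) s' <= K * point_dist z s) ->
  cvg_to_set u S -> cvg_to_set (fun t => f (u t)) S.
Proof.
move=> K0 hf [[s0 Ss0] ucvg]; split; first by exists s0.
have fS z : set_dist (f z) S <= (K + 1) * set_dist z S.
  have K1 : 0 < K + 1 by rewrite ltr_wpDl.
  rewrite -ler_pdivrMl //; apply: lb_le_inf.
    by exists (point_dist z s0), s0.
  move=> _ [s Ss <-]; rewrite ler_pdivrMl //.
  have [s' Ss' h] := hf z s Ss.
  apply: le_trans (set_dist_le (f z) Ss') _; apply: le_trans h _.
  by rewrite ler_wpM2r ?sqrtr_ge0 // lerDl.
apply: (@squeeze_cvgr _ _ _ _ (fun=> 0) (fun t => (K + 1) * set_dist (u t) S)).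
- by near=> t; rewrite set_dist_ge0 fS.
- exact: cvg_cst.
- by rewrite -[X in _ --> X](mulr0 (K + 1)); apply: cvgMr; exact: ucvg.
Unshelve. all: by end_near.
Qed.

(** * The two uses of Hoffman's bound *)

(** Lipschitz bound for the value of a small linear program as a function of
its right-hand side: Hoffman's bound moves y to a feasible point v for x', at
distance O(e), and the minimizer y' does at least as well as v. *)
Lemma small_lp_value_lip (R : realType) (N M n m : nat)
    (Nb : 'I_M -> {set 'I_N}) (A : 'I_N -> 'I_M -> 'M[R]_(n, m))
    (b : 'cV[R]_m) (j : 'I_M) :
  exists2 K : R, 0 <= K &
    forall (x x' : 'I_N -> 'cV[R]_n) (y y' : 'cV[R]_m) (e : R),
    0 <= e ->
    (forall i r, `|x i r 0 - x' i r 0| <= e) ->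
    y_set Nb A x j y -> argmin (dotv b) (y_set Nb A x' j) y' ->
    dotv b y' <= dotv b y + K * e.
Proof.
pose F (p : 'I_N * 'I_n) (v : 'I_m -> R) : R :=
  if p.1 \in Nb j then (A p.1 j *m \col_l v l) p.2 0 else 0.
have FL p : linform (F p).
  rewrite /F; case: (p.1 \in Nb j); last exact: linform0.
  exact: linform_mulmx.
have [C C0 HC] := hoffman_standard_form FL.
pose Q : R := \sum_(p : 'I_N * 'I_n) 1.
have Q0 : 0 <= Q by exact: sumr_ge0.
exists ((\sum_l `|b l 0|) * (C * Q)).
  by rewrite !mulr_ge0 // sumr_ge0.
move=> x x' y y' e e0 xx' [y0 hy] [[y'0 hy'] miny'].
have colK (v : 'cV[R]_m) : \col_l v l 0 = v.
  by apply/matrixP => l s; rewrite mxE ord1.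
have [v [v0 Fv yv]] := HC (y^~ 0) (y'^~ 0) y0 y'0.
have Fv_y' i : i \in Nb j -> A i j *m \col_l v l = x' i.
  move=> ij; rewrite -(hy' i ij); apply/colP => r.
  by have := Fv (i, r); rewrite /F /= ij colK.
apply: le_trans (miny' (\col_l v l) _) _.
  by split=> // l; rewrite mxE.
rewrite -mulrA; apply: dotv_lip => l; rewrite mxE distrC.
apply: le_trans (yv l) _; rewrite -mulrA ler_wpM2l //.
rewrite /Q mulr_suml; apply: ler_sum => -[i r] _; rewrite mul1r /F /=.
case: ifP => ij; last by rewrite subrr normr0.
by rewrite !colK hy // hy'.
Qed.

(** Linear programs have sharp minima.  The solutions are the nonnegative points
that agree with s in all constraints and in the objective, and among these
equations the feasible point z can violate only the one for the objective. *)
Lemma lp_sharp (R : realType) (N M n m k : nat)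
    (Nb : 'I_M -> {set 'I_N})
    (a : 'I_N -> 'cV[R]_n) (b : 'I_M -> 'cV[R]_m) (c : 'I_N -> 'cV[R]_k)
    (A : 'I_N -> 'I_M -> 'M[R]_(n, m)) (B : 'I_N -> 'M[R]_(k, n)) :
  exists2 K : R, 0 <= K & forall z s, feasible Nb A B c z ->
    lp_solutions Nb a b c A B s ->
    exists2 s', lp_solutions Nb a b c A B s' &
      point_dist z s' <= K * (objective a b z - objective a b s).
Proof.
pose V := ('I_N * 'I_n + 'I_M * 'I_m)%type.
pose pt (x : V -> R) : lp_point R N M n m :=
  (fun i => \col_r x (inl (i, r)), fun j => \col_l x (inr (j, l))).
pose coords (z : lp_point R N M n m) (v : V) : R :=
  match v with inl (i, r) => z.1 i r 0 | inr (j, l) => z.2 j l 0 end.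
have coordsK z : pt (coords z) = z.
  case: z => z1 z2; congr pair; apply/funext => i; apply/colP => r;
  by rewrite mxE.
(* The last equation, indexed by unit, fixes the value of the objective. *)
pose F (p : 'I_M * 'I_N * 'I_n + 'I_N * 'I_k + unit) (x : V -> R) : R :=
  match p with
  | inl (inl (j, i, r)) =>
      if i \in Nb j then (A i j *m (pt x).2 j) r 0 + (-1) * x (inl (i, r)) else 0
  | inl (inr (i, r)) => (B i *m (pt x).1 i) r 0
  | inr _ => objective a b (pt x)
  end.
have FL p : linform (F p).
  rewrite /F; case: p => [[[[j i] r]|[i r]]|[]].
  - case: (i \in Nb j); last exact: linform0.
    apply: linform_add; last exact: linform_scaled_coord.
    exact: (linform_mulmx _ (fun l => inr (j, l) : V)).
  - exact: (linform_mulmx _ (fun l => inl (i, l) : V)).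
  - apply: linform_add; apply: linform_sum => i.
      exact: (linform_dotv _ (fun l => inl (i, l) : V)).
    exact: (linform_dotv _ (fun l => inr (i, l) : V)).
have [C C0 HC] := hoffman_standard_form FL.
exists (Num.sqrt (N * n + M * m)%:R * C); first by rewrite mulr_ge0 ?sqrtr_ge0.
move=> z s fz [fs mins].
have cge0 w : feasible Nb A B c w -> forall v, 0 <= coords w v.
  by move=> [h1 h2 _ _] [[i r]|[j l]]; [exact: h1|exact: h2].
have Ffeas w : feasible Nb A B c w -> forall p,
    F p (coords w) = match p with
      | inl (inl _) => 0 | inl (inr (i, r)) => c i r 0 | inr _ => objective a b w end.
  move=> [_ _ h3 h4] [[[[j i] r]|[i r]]|[]]; rewrite /F coordsK //.
    by case: ifP => // ij; rewrite h3 //= mulN1r subrr.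
  by rewrite h4.
have [x [x0 Fx zx]] := HC _ _ (cge0 _ fz) (cge0 _ fs).
have fx : feasible Nb A B c (pt x).
  split=> [i l|j l|j i ij|i]; rewrite ?mxE //.
    apply/colP => r; have := Fx (inl (inl (j, i, r))).
    rewrite Ffeas // /F ij mulN1r => /subr0_eq ->.
    by rewrite mxE.
  by apply/colP => r; have := Fx (inl (inr (i, r))); rewrite Ffeas.
have ox : objective a b (pt x) = objective a b s.
  by have := Fx (inr tt); rewrite Ffeas.
exists (pt x); first by split=> // w fw; rewrite ox mins.
have sumE : \sum_p `|F p (coords z) - F p (coords s)| =
    objective a b z - objective a b s.
  rewrite (bigD1 (inr tt)) //= big1 ?addr0 => [|p].
    by rewrite !coordsK ger0_norm // subr_ge0 mins.
  by rewrite !Ffeas //; case: p => [[[[j i] r]|[i r]]|[]] // _; rewrite subrr normr0.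
rewrite sumE in zx.
rewrite -mulrA; apply: point_dist_le_coord => [|i r|j l].
- by rewrite mulr_ge0 // subr_ge0 mins.
- by rewrite mxE; exact: (zx (inl (i, r))).
- by rewrite mxE; exact: (zx (inr (j, l))).
Qed.

(** The excess objective of P z over s is at most L * 2 * dist (z, s), where L
collects the Lipschitz constants of the linear x-cost and of the values of the
small programs; [lp_sharp] turns this into a distance. *)
Lemma projection_map_calm (R : realType) (N M n m k : nat)
    (Nb : 'I_M -> {set 'I_N})
    (a : 'I_N -> 'cV[R]_n) (b : 'I_M -> 'cV[R]_m) (c : 'I_N -> 'cV[R]_k)
    (A : 'I_N -> 'I_M -> 'M[R]_(n, m)) (B : 'I_N -> 'M[R]_(k, n))
    (P : lp_point R N M n m -> lp_point R N M n m) :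
  is_projection_map Nb b c A B P ->
  exists2 K : R, 0 <= K & forall z s, lp_solutions Nb a b c A B s ->
    exists2 s', lp_solutions Nb a b c A B s' &
      point_dist (P z) s' <= K * point_dist z s.
Proof.
move=> hP; have [K1 K10 HK1] := lp_sharp Nb a b c A B.
have /choice[K2 HK2] : forall j, exists K : R, 0 <= K /\
    forall (x x' : 'I_N -> 'cV[R]_n) (y y' : 'cV[R]_m) (e : R),
    0 <= e ->
    (forall i r, `|x i r 0 - x' i r 0| <= e) ->
    y_set Nb A x j y -> argmin (dotv (b j)) (y_set Nb A x' j) y' ->
    dotv (b j) y' <= dotv (b j) y + K * e.
  by move=> j; have [K] := small_lp_value_lip Nb A (b j) j; exists K.
pose L := \sum_i \sum_l `|a i l 0| + \sum_j K2 j.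
have L0 : 0 <= L.
  rewrite addr_ge0 //; apply: sumr_ge0 => j _; first exact: sumr_ge0.
  by have [] := HK2 j.
exists (K1 * (L * 2)); first by rewrite !mulr_ge0.
move=> z s Ss; have [[s1 s2 s3 s4] mins] := Ss; have [hx hy] := hP z.
set d := point_dist z s.
have d0 : 0 <= d * 2 by rewrite mulr_ge0 // sqrtr_ge0.
have zs i l : `|(P z).1 i l 0 - s.1 i l 0| <= d * 2.
  (* The projection (P z).1 i is at least as close to z.1 i as s.1 i is. *)
  have zs1 : enorm (z.1 i - s.1 i) <= d by exact: enorm_le_point_dist1.
  have zP1 : enorm (z.1 i - (P z).1 i) <= d.
    by have [_ h] := hx i; apply: le_trans zs1; apply: h.
  have := enorm_coord (z.1 i - s.1 i) l.
  have := enorm_coord (z.1 i - (P z).1 i) l; rewrite !mxE => h1 h2.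
  rewrite -[_ - _](subrKA (z.1 i l 0)) mulr2n mulrDr mulr1.
  apply: le_trans (ler_normD _ _) (lerD _ _); last exact: le_trans h2 zs1.
  by rewrite distrC; exact: le_trans h1 zP1.
have [s' Ss' h] := HK1 _ s (projection_map_feasible hP z) Ss.
exists s' => //; apply: le_trans h _.
rewrite -!mulrA; apply: ler_wpM2l => //; rewrite [2 * _]mulrC lerBlDl.
rewrite /L mulrDl !mulr_suml addrACA -!big_split /=.
apply: lerD; apply: ler_sum => i _; first exact: dotv_lip.
have [_ hK] := HK2 i; apply: (hK s.1 (P z).1) => //.
- by move=> i' r; rewrite distrC.
- by split=> // i' ii'; exact: s3.
Qed.


Theorem mainTheorem1 (R : realType) (N M n m k : nat) (hkn : (k < n)%N)
    (Nb : 'I_M -> {set 'I_N})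
    (a : 'I_N -> 'cV[R]_n) (b : 'I_M -> 'cV[R]_m) (c : 'I_N -> 'cV[R]_k)
    (A : 'I_N -> 'I_M -> 'M[R]_(n, m)) (B : 'I_N -> 'M[R]_(k, n))
    (P : lp_point R N M n m -> lp_point R N M n m)
    (hP : is_projection_map Nb b c A B P)
    (u : nat -> lp_point R N M n m)
    (hu : cvg_to_set u (lp_solutions Nb a b c A B)) :
  cvg_to_set (fun t => P (u t)) (lp_solutions Nb a b c A B).
Proof.
have [K K0 HK] := projection_map_calm a hP.
exact: cvg_to_set_calm K0 HK hu.
Qed.
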